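(* Let $p\ge q\ge1$ be integers, $n=p+q$, and let $\mathbf r=(r_1,\dots,r_n)$ be positive real numbers with $\sum_{i=1}^n r_i=2$. Let $M=(\mathbf z\ \mathbf w)$ be a complex $n\times2$ matrix with rows $(z_i,w_i)$ such that $$J_{1,1}M^*J_{p,q}M=I_2,\qquad \varepsilon_i\left(|z_i|^2-|w_i|^2\right)=r_i\quad(1\le i\le n),$$ where $\varepsilon_i=1$ for $i\le p$ and $\varepsilon_i=-1$ for $i>p$; let $(\mathbf u_1,\dots,\mathbf u_n)$ be the corresponding closed polygon in Minkowski 3-space. For $2\le\ell\le n$ let $M_\ell$ be the $\ell\times2$ matrix formed by the first $\ell$ rows of $M$, let $J^{(\ell)}=\mathrm{diag}(\varepsilon_1,\dots,\varepsilon_\ell)$, and let $A_\ell=M_\ell J_{1,1}M_\ell^*J^{(\ell)}$. Let $\gamma_\ell\le\delta_\ell$ be the two eigenvalues of $A_\ell$ complementing its $\ell-2$ zero eigenvalues; these are real and equal to the eigenvalues of the $2\times 2$ matrix $J_{1,1}M_\ell^*J^{(\ell)}M_\ell$. Then $$\gamma_\ell+\delta_\ell=\sum_{i=1}^\ell r_i\qquad\text{and}\qquad \delta_\ell-\gamma_\ell=d_\ell,$$ where $d_\ell$ is the Minkowski length of the $\ell$-th diagonal $\mathbf u_1+\cdots+\mathbf u_\ell$ of the polygon.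
   Context: Here $M^*=\overline M^{\,T}$, $J_{1,1}=\mathrm{diag}(1,-1)$, and $J_{p,q}=\mathrm{diag}(1,\dots,1,-1,\dots,-1)$ with $p$ entries $1$ and $q$ entries $-1$. The maps $\eta(M)=MJ_{1,1}M^*J_{p,q}$ and $\nu(M)=J_{1,1}M^*J_{p,q}M$ are the moment maps for the left $\mathrm U(p,q)$-action and right $\mathrm U(1,1)$-action on the space $\mathbb C^{2n}$ of $n\times2$ matrices. The diagonal entries of $\eta(M)$ are $\varepsilon_i(|z_i|^2-|w_i|^2)$, and $A_\ell$ is the upper left principal $\ell\times\ell$ submatrix of $\eta(M)$. Minkowski 3-space is $\mathbb R^3$ with coordinates $(x,y,t)$ and quadratic form $t^2-x^2-y^2$; the Minkowski length of a vector with $t^2-x^2-y^2\ge0$ is $\sqrt{t^2-x^2-y^2}$. Correspondence between $M$ and polygons: row $i$ of $M$ determines the vector $\mathbf u_i=(x_i,y_i,t_i)$ given by $$t_i=\varepsilon_i(|z_i|^2+|w_i|^2),\qquad x_i+\sqrt{-1}\,y_i=2\varepsilon_i\,\bar z_iw_i,$$ that is, the traceless part of the $2\times2$ matrix $\varepsilon_iJ_{1,1}(z_i,w_i)^*(z_i,w_i)$ equals $\frac12\begin{pmatrix}t_i&x_i+\sqrt{-1}y_i\\-(x_i-\sqrt{-1}y_i)&-t_i\end{pmatrix}$. The vector $\mathbf u_i$ has Minkowski length $r_i$; it is future timelike ($t_i>0$) for $i\le p$ and past timelike ($t_i<0$) for $i>p$. The condition $\nu(M)=I_2$ gives $\mathbf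 u_1+\cdots+\mathbf u_n=0$, i.e. the polygon is closed. *)

(* Defs.v *)
From HB Require Import structures.
From mathcomp Require Import all_boot all_order all_algebra.
From mathcomp Require Import reals complex.

Set Implicit Arguments.
Unset Strict Implicit.
Unset Printing Implicit Defensive.

Import Order.TTheory GRing.Theory Num.Theory.
Local Open Scope ring_scope.
Local Open Scope complex_scope.

(* Rows are numbered from 0, so the p positive signs are those of the indices
   i < p. *)
Definition eps (S : pzRingType) (p i : nat) : S := if (i < p)%N then 1 else -1.
Arguments eps {S} p i.

(* J_{p,q} is [Jmx p (p + q)], J_{1,1} is [Jmx 1 2], and J^(l) is [Jmx p l]. *)
Definition Jmx {S : pzRingType} (p m : nat) : 'M[S]_m :=
  diag_mx (\row_(i < m) eps p i).

Definition adjmx {C : numClosedFieldType} (m k : nat) (M : 'M[C]_(m, k)) :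
  'M[C]_(k, m) := map_mx Num.conj M^T.

(* The moment maps eta (left) and nu (right), for the sign matrix whose first p
   signs are positive; the number m of rows is arbitrary so that they also
   apply to the truncations of an n x 2 matrix to its first rows. *)
Definition left_moment {C : numClosedFieldType} (p m : nat) (M : 'M[C]_(m, 2)) :
  'M[C]_m := M *m Jmx 1%N 2%N *m adjmx M *m Jmx p m.

Definition right_moment {C : numClosedFieldType} (p m : nat) (M : 'M[C]_(m, 2)) :
  'M[C]_2 := Jmx 1%N 2%N *m adjmx M *m Jmx p m *m M.

Definition first_rows {C : Type} (n k l : nat) (le_ln : (l <= n)%N)
  (M : 'M[C]_(n, k)) : 'M[C]_(l, k) := rowsub (widen_ord le_ln) M.

(* s lists the eigenvalues of A with their algebraic multiplicities. *)
Definition has_eigenvalues {C : comNzRingType} (m : nat) (A : 'M[C]_m)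
  (s : seq C) : Prop := char_poly A = \prod_(a <- s) ('X - a%:P).

(* Vectors of Minkowski space are rows (x, y, t). *)
Definition minkowski_form {R : realType} (v : 'rV[R]_3) : R :=
  v 0 2%:R ^+ 2 - v 0 0 ^+ 2 - v 0 1 ^+ 2.

(* Only meaningful when [0 <= minkowski_form v], [Num.sqrt] being 0 on negative
   numbers. *)
Definition minkowski_length {R : realType} (v : 'rV[R]_3) : R :=
  Num.sqrt (minkowski_form v).

Definition polygon_edge {R : realType} (p m : nat) (M : 'M[R[i]]_(m, 2))
  (i : 'I_m) : 'rV[R]_3 :=
  let z := M i 0 in
  let w := M i 1 in
  let xy : R[i] := 2%:R * eps p i * Num.conj z * w in
  let t : R[i] := eps p i * (`|z| ^+ 2 + `|w| ^+ 2) in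
  \row_(k < 3) [:: complex.Re xy; complex.Im xy; complex.Re t]`_k.

Definition polygon_diagonal {R : realType} (p m : nat) (M : 'M[R[i]]_(m, 2))
  (l : nat) : 'rV[R]_3 := \sum_(i < m | (i < l)%N) polygon_edge p M i.

(* Main.v *)
Require Import Defs.
From HB Require Import structures.
From mathcomp Require Import all_boot all_order all_algebra.
From mathcomp Require Import reals complex ring lra.

Set Implicit Arguments.
Unset Strict Implicit.
Unset Printing Implicit Defensive.

Import Order.TTheory GRing.Theory Num.Theory.
Local Open Scope ring_scope.
Local Open Scope complex_scope.

(** The nonzero eigenvalues of [A_l] are those of the 2 x 2 matrix
    [B = (a, c; - c^*, - b)], the right moment of the truncation, where [a], [b]
    and [c] are the signed sums of [|z_i|^2], [|w_i|^2] and [z_i^* w_i] over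
    [i <= l]. Its trace [a - b] is [r_1 + ... + r_l], and its discriminant
    [(a - b)^2 + 4 (a b - |c|^2) = (a + b)^2 - |2 c|^2] is the Minkowski form of
    the l-th diagonal. The discriminant is nonnegative because that diagonal,
    or the opposite sum of the remaining edges when [l > p] since the polygon is
    closed, is a sum of causal vectors lying in a common half-cone. *)

(** * Characteristic polynomials of products and of 2 x 2 matrices *)

Lemma det_mx22 (S : comPzRingType) (A : 'M[S]_2) :
  \det A = A 0 0 * A 1 1 - A 0 1 * A 1 0.
Proof.
rewrite (expand_det_row _ 0) !big_ord_recl big_ord0 /cofactor !det_mx11 !mxE /=.
rewrite expr0 mul1r (_ : (0 + _)%N = 1%N) // expr1 mulN1r mulrN addr0.
by congr (_ * A _ _ - A _ _ * A _ _); exact/val_inj.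
Qed.

(* Both sides come from the determinant of the block matrix (X A; B 1), which
   the unitriangular (1 0; -B 1) and the block triangular (1 -A; 0 X) multiply
   into block triangular matrices. *)
Lemma char_poly_mulmxC (S : comNzRingType) (m k : nat)
    (A : 'M[S]_(m, k)) (B : 'M[S]_(k, m)) :
  'X^k * char_poly (A *m B) = 'X^m * char_poly (B *m A).
Proof.
pose a := map_mx polyC A; pose b := map_mx polyC B.
pose D := block_mx ('X%:M : 'M[{poly S}]_m) a b (1%:M : 'M_k).
have detD : \det D = char_poly (A *m B).
  rewrite -[LHS]mulr1.
  have <- : \det (block_mx (1%:M : 'M[{poly S}]_m) 0 (- b) (1%:M : 'M_k)) = 1.
    by rewrite det_lblock !det1 mulr1.
  rewrite -det_mulmx mulmx_block !mulmx1 !mul1mx !mulmx0 addrN !add0r.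
  by rewrite det_ublock det1 mulr1 mulmxN -map_mxM.
have : \det (D *m block_mx (1%:M : 'M[{poly S}]_m) (- a) 0 ('X%:M : 'M_k))
       = 'X^m * char_poly (B *m A).
  rewrite mulmx_block !mulmx1 !mul1mx !mulmx0 !addr0 !mulmxN.
  rewrite scalar_mxC addNr det_lblock det_scalar; congr (_ * \det _).
  by rewrite /char_poly_mx map_mxM addrC.
rewrite det_mulmx det_ublock det1 mul1r det_scalar detD => <-.
by rewrite mulrC.
Qed.

(** The list [nseq (m - k) 0] contributes the factor ['X^(m - k)], so each direction follows from
    [char_poly_mulmxC] by cancelling a power of ['X], which is nonzero in the domain [{poly F}]. *)
Lemma has_eigenvalues_mulmxC (F : fieldType) (m k : nat)
    (A : 'M[F]_(m, k)) (B : 'M[F]_(k, m)) (s : seq F) : (k <= m)%N ->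
  has_eigenvalues (A *m B) (nseq (m - k) 0 ++ s) <->
  has_eigenvalues (B *m A) s.
Proof.
move=> le_km; rewrite /has_eigenvalues big_cat /= big_nseq.
rewrite -Monoid.iteropE /= subr0.
have Xn0 n : 'X^n != 0 :> {poly F} by rewrite monic_neq0 ?monicXn.
have eqX := char_poly_mulmxC A B.
split=> [chAB|chBA].
  by apply: (mulfI (Xn0 m)); rewrite -eqX chAB mulrA -exprD subnKC.
by apply: (mulfI (Xn0 k)); rewrite eqX chBA mulrA -exprD subnKC.
Qed.

Lemma char_poly_mx22 (S : comNzRingType) (B : 'M[S]_2) :
  char_poly B = 'X^2 - \tr B *: 'X + (\det B)%:P.
Proof.
rewrite /char_poly !det_mx22 /mxtrace !big_ord_recl big_ord0 !mxE /=.
rewrite -mul_polyC !rmorphD !rmorphN !rmorphM /= !mulr1n !mulr0n addr0.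
rewrite (_ : lift 0 0 = 1); last exact/val_inj.
ring.
Qed.

Lemma has_eigenvalues_mx22 (F : comNzRingType) (B : 'M[F]_2) (a b : F) :
  has_eigenvalues B [:: a; b] <-> a + b = \tr B /\ a * b = \det B.
Proof.
rewrite /has_eigenvalues char_poly_mx22 !big_cons big_nil mulr1.
have -> : ('X - a%:P) * ('X - b%:P) = 'X^2 - (a + b) *: 'X + (a * b)%:P.
  by rewrite -mul_polyC rmorphD rmorphM /=; ring.
split=> [eqP|[-> ->] //].
(* Vieta: the coefficients of degree 1 and 0 give the sum and the product. *)
have := congr1 (fun P : {poly F} => P`_1) eqP.
have := congr1 (fun P : {poly F} => P`_0) eqP.
rewrite !(coefD, coefN, coefZ, coefX, coefXn, coefC) /=.
rewrite !(mulr0, mulr1, subr0, sub0r, oppr0, addr0, add0r) => -> /oppr_inj -> //.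
Qed.

(** Once the sum is fixed, prescribing the product amounts to prescribing the squared difference,
    because (gamma + delta)^2 - 4 gamma delta = (delta - gamma)^2. The order of the pair selects the
    nonnegative square root. *)
Lemma has_eigenvalues_real2 (R : rcfType) (B : 'M[R[i]]_2) (T d gamma delta : R) :
  0 <= d -> \tr B = T%:C -> \tr B ^+ 2 - 4%:R * \det B = d%:C ->
  gamma <= delta ->
  has_eigenvalues B [:: gamma%:C; delta%:C] <->
  gamma + delta = T /\ delta - gamma = Num.sqrt d.
Proof.
move=> d0 trB discB le_gd; rewrite has_eigenvalues_mx22; split.
  rewrite trB -rmorphD /= => -[/complexI sumT mulD]; split=> //.
  have -> : d = (delta - gamma) ^+ 2.
    apply: complexI; rewrite -discB -mulD trB -sumT.
    by rewrite !(rmorphXn, rmorphB, rmorphD) /=; ring.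
  by rewrite sqrtr_sqr ger0_norm // subr_ge0.
case=> sumT difd; rewrite trB -sumT rmorphD; split=> //.
(* The discriminant only determines [4%:R * \det B], so the factor 4 has to be cancelled. *)
have n40 : 4%:R != 0 :> R[i] by rewrite pnatr_eq0.
apply: (mulfI n40); apply/eqP; rewrite -subr_eq0; apply/eqP.
have : \tr B ^+ 2 - 4%:R * \det B = ((delta - gamma) ^+ 2)%:C.
  by rewrite discB difd sqr_sqrtr.
rewrite trB -sumT !(rmorphXn, rmorphB, rmorphD) /=.
by move/eqP; rewrite -subr_eq0 => /eqP <-; ring.
Qed.

(** * Entries of the right moment and auxiliary facts on signs *)

Lemma right_momentE (C : numClosedFieldType) (p m : nat) (M : 'M[C]_(m, 2)) i j :
  right_moment p M i j =
  eps 1 i * \sum_(k < m) eps p k * (Num.conj (M k i) * M k j).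
Proof.
rewrite /right_moment /Jmx -!mulmxA mul_diag_mx !mxE; congr (_ * _).
by apply: eq_bigr => k _; rewrite mul_diag_mx !mxE mulrCA.
Qed.

(** Summing over the rows of [M] with a condition, rather than over ['I_l], matches the index set of
    [polygon_diagonal]. *)
Lemma right_moment_first_rowsE (C : numClosedFieldType) (p n l : nat)
    (M : 'M[C]_(n, 2)) (le_ln : (l <= n)%N) i j :
  right_moment p (first_rows le_ln M) i j =
  eps 1 i * \sum_(k < n | (k < l)%N) eps p k * (Num.conj (M k i) * M k j).
Proof.
rewrite right_momentE big_ord_narrow; congr (_ * _).
by apply: eq_bigr => k _; rewrite !mxE.
Qed.

Lemma conj_eps (C : numClosedFieldType) (p k : nat) :
  Num.conj (eps p k : C) = eps p k.
Proof. by rewrite /eps; case: ifP; rewrite ?rmorphN rmorph1. Qed.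

Lemma Re_sum (R : rcfType) (I : Type) (s : seq I) (P : pred I) (F : I -> R[i]) :
  complex.Re (\sum_(i <- s | P i) F i) = \sum_(i <- s | P i) complex.Re (F i).
Proof. by apply: (big_morph (@complex.Re R)) => // -[a b] [c d]. Qed.

Lemma Im_sum (R : rcfType) (I : Type) (s : seq I) (P : pred I) (F : I -> R[i]) :
  complex.Im (\sum_(i <- s | P i) F i) = \sum_(i <- s | P i) complex.Im (F i).
Proof. by apply: (big_morph (@complex.Im R)) => // -[a b] [c d]. Qed.

Lemma eps_real (C : numClosedFieldType) (p k : nat) : (eps p k : C) \is Num.real.
Proof. by rewrite /eps; case: ifP; rewrite ?realN real1. Qed.

Lemma norm_eps (C : numClosedFieldType) (p k : nat) : `|eps p k : C| = 1.
Proof. by rewrite /eps; case: ifP; rewrite ?normrN normr1. Qed.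

(** * Causality of edges and of their sums; closing of the polygon *)

Section Edges.
Variables (R : realType) (p m : nat) (M : 'M[R[i]]_(m, 2)).

(** The horizontal part x + iy is kept as one complex number, which turns the Minkowski form into
    t^2 - |x + iy|^2, computed in [R[i]]. *)
Definition edge_xy (i : 'I_m) : R[i] :=
  2%:R * eps p i * Num.conj (M i 0) * M i 1.

Definition edge_t (i : 'I_m) : R[i] :=
  eps p i * (`|M i 0| ^+ 2 + `|M i 1| ^+ 2).

Lemma edge_t_real i : edge_t i \is Num.real.
Proof. by rewrite realM ?eps_real // realD // realX // normr_real. Qed.

(* AM-GM; geometrically, every edge is causal. *)
Lemma norm_edge_xy i : `|edge_xy i| <= `|edge_t i|.
Proof.
rewrite /edge_xy /edge_t !normrM !norm_eps norm_conjC normr_nat mulr1 mul1r.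
rewrite [`|_ + _|]ger0_norm ?addr_ge0 ?exprn_ge0 // -subr_ge0.
rewrite (_ : _ - _ = (`|M i 0| - `|M i 1|) ^+ 2); last ring.
by rewrite real_exprn_even_ge0 // realB // normr_real.
Qed.

Lemma sum_polygon_edgeE (P : pred 'I_m) :
  \sum_(i | P i) polygon_edge p M i =
  \row_(k < 3) [:: complex.Re (\sum_(i | P i) edge_xy i);
                   complex.Im (\sum_(i | P i) edge_xy i);
                   complex.Re (\sum_(i | P i) edge_t i)]`_k.
Proof.
apply/rowP=> k; rewrite summxE !mxE.
case: k => -[|[|[|//]]] k3 /=; rewrite (Re_sum, Im_sum);
  by apply: eq_bigr => i _; rewrite mxE.
Qed.

Lemma minkowski_form_sum_polygon_edge (P : pred 'I_m) :
  (minkowski_form (\sum_(i | P i) polygon_edge p M i))%:C =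
  (\sum_(i | P i) edge_t i) ^+ 2 - `|\sum_(i | P i) edge_xy i| ^+ 2.
Proof.
rewrite sum_polygon_edgeE /minkowski_form !mxE /= -add_Re2_Im2.
(* The edge stores only the real part of t; as t is real, nothing is lost. *)
have tR : \sum_(i | P i) edge_t i \is Num.real.
  by apply: sum_real => i _; exact: edge_t_real.
by rewrite -addrA -opprD rmorphB rmorphXn /= RRe_real.
Qed.

(** With a common sign the times do not cancel, so |sum of t| equals the sum of the |t|, which
    bounds the sum of the |x + iy| edge by edge, hence |sum of x + iy|. *)
Lemma minkowski_form_same_sign_ge0 (P : pred 'I_m) (b : bool) :
  (forall i, P i -> (i < p)%N = b) ->
  0 <= minkowski_form (\sum_(i | P i) polygon_edge p M i).
Proof.
move=> Pb; rewrite -lecR minkowski_form_sum_polygon_edge subr_ge0.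
have -> : (\sum_(i | P i) edge_t i) ^+ 2 = (\sum_(i | P i) `|edge_t i|) ^+ 2.
  rewrite (_ : \sum_(i | P i) edge_t i =
               (if b then 1 else -1) * \sum_(i | P i) `|edge_t i|).
    by rewrite exprMn; case: b {Pb}; rewrite ?sqrrN expr1n mul1r.
  rewrite mulr_sumr; apply: eq_bigr => i /Pb <-.
  by rewrite /edge_t normrM norm_eps mul1r ger0_norm // addr_ge0 ?exprn_ge0.
rewrite ler_sqr ?nnegrE ?sumr_ge0 //.
by apply: le_trans (ler_norm_sum _ _ _) _; apply: ler_sum => i _; exact: norm_edge_xy.
Qed.

End Edges.

Lemma minkowski_formN (R : realType) (v : 'rV[R]_3) :
  minkowski_form (- v) = minkowski_form v.
Proof. by rewrite /minkowski_form !mxE !sqrrN. Qed.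

(** The edges sum to the traceless part of the right moment: the total t is the difference of its
    diagonal entries, the total x + iy is twice its upper right entry. Both vanish for a scalar
    matrix. *)
Lemma sum_polygon_edge_eq0 (R : realType) (p m : nat) (M : 'M[R[i]]_(m, 2)) :
  right_moment p M = 1%:M -> \sum_i polygon_edge p M i = 0.
Proof.
move=> nuM; have nuE i j : right_moment p M i j = (i == j)%:R by rewrite nuM mxE.
have t0 : \sum_i edge_t p M i = 0.
  transitivity (right_moment p M 0 0 - right_moment p M 1 1); last by rewrite !nuE subrr.
  rewrite !right_momentE /eps /= mul1r mulN1r opprK -big_split /=.
  by apply: eq_bigr => i _; rewrite /edge_t !normCKC mulrDr.
have xy0 : \sum_i edge_xy p M i = 0.
  transitivity (2%:R * right_moment p M 0 1); last by rewrite nuE mulr0.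
  rewrite right_momentE /eps /= mul1r mulr_sumr.
  by apply: eq_bigr => i _; rewrite /edge_xy !mulrA.
rewrite sum_polygon_edgeE t0 xy0; apply/rowP=> k; rewrite !mxE.
by case: k => -[|[|[|]]].
Qed.

Lemma minkowski_form_polygon_diagonal_ge0 (R : realType) (p m l : nat)
    (M : 'M[R[i]]_(m, 2)) :
  right_moment p M = 1%:M -> 0 <= minkowski_form (polygon_diagonal p M l).
Proof.
move=> nuM; have [le_lp|lt_pl] := leqP l p.
  by apply: (@minkowski_form_same_sign_ge0 _ _ _ _ _ true) => i /leq_trans ->.
(* Here the first l edges have mixed signs, but all the remaining ones have index at least p and are
   past-directed. *)
have -> : polygon_diagonal p M l = - \sum_(i < m | ~~ (i < l)%N) polygon_edge p M i.
  apply/eqP; rewrite -addr_eq0 /polygon_diagonal.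
  by rewrite -(bigID (fun i : 'I_m => (i < l)%N) predT) sum_polygon_edge_eq0.
rewrite minkowski_formN; apply: (@minkowski_form_same_sign_ge0 _ _ _ _ _ false) => i.
by rewrite -leqNgt => /(leq_trans (ltnW lt_pl)); rewrite leqNgt => /negbTE.
Qed.

(** * Trace and discriminant of the truncated right moment *)

Section TruncatedMoment.
Variables (R : realType) (p n l : nat) (M : 'M[R[i]]_(n, 2)) (le_ln : (l <= n)%N).

Lemma tr_right_moment_first_rows :
  \tr (right_moment p (first_rows le_ln M)) =
  \sum_(i < n | (i < l)%N) eps p i * (`|M i 0| ^+ 2 - `|M i 1| ^+ 2).
Proof.
rewrite /mxtrace !big_ord_recl big_ord0 addr0.
rewrite !right_moment_first_rowsE /eps /= mul1r mulN1r -sumrB.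
apply: eq_bigr => i _; rewrite (_ : lift 0 0 = 1); last exact/val_inj.
by rewrite !normCKC mulrBr.
Qed.

Lemma disc_right_moment_first_rows :
  \tr (right_moment p (first_rows le_ln M)) ^+ 2
    - 4%:R * \det (right_moment p (first_rows le_ln M)) =
  (minkowski_form (polygon_diagonal p M l))%:C.
Proof.
rewrite minkowski_form_sum_polygon_edge tr_right_moment_first_rows det_mx22.
rewrite !right_moment_first_rowsE.
pose S (f : 'I_n -> R[i]) := \sum_(i < n | (i < l)%N) eps p i * f i.
pose a := S (fun i => `|M i 0| ^+ 2); pose b := S (fun i => `|M i 1| ^+ 2).
pose c := S (fun i => Num.conj (M i 0) * M i 1).
rewrite (_ : \sum_(i < n | _) _ * (_ - _) = a - b); last first.
  by rewrite -sumrB; apply: eq_bigr => i _; rewrite mulrBr.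
rewrite (_ : \sum_(i < n | _) edge_t p M i = a + b); last first.
  by rewrite -big_split; apply: eq_bigr => i _; rewrite /edge_t mulrDr.
rewrite (_ : \sum_(i < n | _) edge_xy p M i = 2%:R * c); last first.
  by rewrite mulr_sumr; apply: eq_bigr => i _; rewrite /edge_xy !mulrA.
rewrite (_ : \sum_(k < n | _) eps p k * (Num.conj (M k 0) * M k 0) = a); last first.
  by apply: eq_bigr => i _; rewrite normCKC.
rewrite (_ : \sum_(k < n | _) eps p k * (Num.conj (M k 1) * M k 1) = b); last first.
  by apply: eq_bigr => i _; rewrite normCKC.
(* As the signs are real, the two off-diagonal sums are conjugate; the determinant becomes |c|^2 - a
   b, and (a - b)^2 + 4 (a b - |c|^2) = (a + b)^2 - 4 |c|^2 concludes. *)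
rewrite (_ : \sum_(k < n | _) eps p k * (Num.conj (M k 1) * M k 0) = Num.conj c).
  rewrite -/c normrM normr_nat exprMn normCK -!/(S _) -/c /eps /=; ring.
rewrite /c /S rmorph_sum; apply: eq_bigr => i _.
by rewrite !rmorphM /= conjCK conj_eps mulrC [M _ _ * _]mulrC mulrC.
Qed.

End TruncatedMoment.

Theorem mainTheorem2 (R : realType) (p q : nat) (q_ge1 : (1 <= q)%N)
    (le_qp : (q <= p)%N)
    (r : 'I_(p + q) -> R) (r_gt0 : forall i, 0 < r i)
    (sum_r : \sum_i r i = 2%:R)
    (M : 'M[R[i]]_(p + q, 2))
    (nuM : right_moment p M = 1%:M)
    (diagM : forall i : 'I_(p + q),
       eps p i * (`|M i 0| ^+ 2 - `|M i 1| ^+ 2) = (r i)%:C)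
    (l : nat) (l_ge2 : (2 <= l)%N) (le_ln : (l <= p + q)%N) :
  let Ml := first_rows le_ln M in
  let complementing_eigenvalues (gamma delta : R) :=
    gamma <= delta /\
    has_eigenvalues (left_moment p Ml) (nseq (l - 2)%N 0 ++ [:: gamma%:C; delta%:C]) in
  (exists gamma delta : R, complementing_eigenvalues gamma delta) /\
  0 <= minkowski_form (polygon_diagonal p M l) /\
  (forall gamma delta : R, complementing_eigenvalues gamma delta ->
    [/\ has_eigenvalues (right_moment p Ml) [:: gamma%:C; delta%:C],
        gamma + delta = \sum_(i < p + q | (i < l)%N) r i
      & delta - gamma = minkowski_length (polygon_diagonal p M l)]).
Proof.
move=> Ml complementing_eigenvalues.
have form_ge0 := minkowski_form_polygon_diagonal_ge0 l nuM.
have trE : \tr (right_moment p Ml) = (\sum_(i < p + q | (i < l)%N) r i)%:C.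
  rewrite tr_right_moment_first_rows rmorph_sum.
  by apply: eq_bigr => i _; exact: diagM.
have rightP gamma delta : gamma <= delta ->
    has_eigenvalues (right_moment p Ml) [:: gamma%:C; delta%:C] <->
    gamma + delta = \sum_(i < p + q | (i < l)%N) r i /\
    delta - gamma = minkowski_length (polygon_diagonal p M l).
  exact: has_eigenvalues_real2 form_ge0 trE (disc_right_moment_first_rows _ _ _).
have leftP s : has_eigenvalues (left_moment p Ml) (nseq (l - 2) 0 ++ s) <->
    has_eigenvalues (right_moment p Ml) s.
  (* The left and right moments are the two products, in opposite orders, of [Ml] and one common
     factor. *)
  have := has_eigenvalues_mulmxC Ml (Jmx 1 2 *m adjmx Ml *m Jmx p l) s l_ge2.
  by rewrite !mulmxA.
split; last split=> // gamma delta [le_gd /leftP right_gd].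
  pose T := \sum_(i < p + q | (i < l)%N) r i.
  pose d := minkowski_length (polygon_diagonal p M l).
  (* The unique solution of gamma + delta = T and delta - gamma = d, ordered since [d] is a square
     root and hence nonnegative. *)
  exists ((T - d) / 2%:R), ((T + d) / 2%:R).
  have d_ge0 : 0 <= d by exact: sqrtr_ge0.
  have le_gd : (T - d) / 2%:R <= (T + d) / 2%:R by lra.
  by split=> //; apply/leftP/rightP => //; split; rewrite -/T -/d; lra.
by have [] := (rightP _ _ le_gd).1 right_gd; split.
Qed.
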